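(* Let $K$ be a commutative semiring and $A$ a finite alphabet. For every closed $\mu$-expression $t\in\mathcal{T}_\mu$ over $K$, the power series $[\![t]\!]\in K\langle\langle A\rangle\rangle$ is context-free (constructively algebraic); in particular, for $K=\mathbb{B}$, $[\![t]\!]$ is a context-free language.
   Context: $K\langle\langle A\rangle\rangle$ is the set of functions $A^*\to K$, the final $K\times(-)^A$-coalgebra with $o(\sigma)=\sigma(\epsilon)$ and $\sigma_a(w)=\sigma(aw)$. For a finite set $X$, $K\langle X\rangle$ denotes the semiring of finitely supported functions $X^*\to K$ (noncommutative polynomials). Given $(o,\delta):X\to K\times K\langle X\rangle^A$ (write $x_a=\delta(x)(a)$), its extension to a $K\times(-)^A$-coalgebra on $K\langle X\rangle$ is: $\hat o(1)=1$, $1_a=0$; for $x\in X$, $w\in X^*$: $\hat o(xw)=o(x)\hat o(w)$, $(xw)_a=x_aw+o(x)w_a$; and linearly $\hat o(\sum k_iw_i)=\sum k_i\hat o(w_i)$, $(\sum k_iw_i)_a=\sum k_i(w_i)_a$. A power series is context-free (constructively algebraic) if it equals $[\![p]\!]$ for some finite $X$, some such $(o,\delta)$ and some $p\in K\langle X\rangle$, $[\![-]\!]$ being the final homomorphism from the extension. $\mu$-expressions over a countably infinite variable set $V$: $t::=\bar k\ (k\in K)\mid x\ (x\in V)\mid \bar a\ (a\in A)\mid t+t\mid t\times t\mid \mu x.g$, with guarded terms $g::=\bar a\times t\ (a\in A)\mid \bar k\ (k\in K)\mid g+g$ ($\mu x$ binds $x$). $\mathcal{T}_\mu$ is the set of closed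 $\mu$-expressions, a $K\times(-)^A$-coalgebra via: $o(\bar k)=k$, $\bar k_a=\bar 0$; $o(\bar b)=0$, $\bar b_a=\bar 1$ if $b=a$ else $\bar 0$; $o(u+v)=o(u)+o(v)$, $(u+v)_a=u_a+v_a$; $o(u\times v)=o(u)\cdot o(v)$, $(u\times v)_a=(u_a\times v)+(\overline{o(u)}\times v_a)$; $o(\mu x.u)=o(u[\mu x.u/x])$, $(\mu x.u)_a=(u[\mu x.u/x])_a$, where $u[\mu x.u/x]$ substitutes $\mu x.u$ for the free occurrences of $x$. $[\![-]\!]:\mathcal{T}_\mu\to K\langle\langle A\rangle\rangle$ is the final homomorphism.
   Formalization: In (u×v)_a the summand 0̄×v_a is dropped when u is a letter: literally, s=μx.(b̄×x) would need a finite term s_a=(b̄_a×s)+(0̄×s_a), which does not exist. The dropped summand denotes the zero series, so the full clause still holds for the semantics. *)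

(* Defs.v *)
Set Warnings "-notation-overridden,-ambiguous-paths,-redundant-canonical-projection,-notation-incompatible-prefix".
From HB Require Import structures.
From Stdlib Require Import Relations.
From mathcomp Require Import all_boot all_order all_algebra.
From mathcomp Require Import finmap.

Set Implicit Arguments.
Unset Strict Implicit.
Unset Printing Implicit Defensive.

Import GRing.Theory.
Local Open Scope fset_scope.
Local Open Scope ring_scope.

Record coalg (K A : Type) := Coalg {
  state :> Type;
  out : state -> K;
  der : state -> A -> state }.

Definition series (K A : Type) := seq A -> K.

Definition series_coalg (K A : Type) : coalg K A :=
  @Coalg K A (series K A) (fun s => s [::]) (fun s a w => s (a :: w)).

Definition is_hom (K A : Type) (S T : coalg K A) (f : S -> T) : Prop :=
  (forall s, out (f s) = out s) /\ (forall s a, der (f s) a = f (der s a)).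

(* The homomorphism into the final coalgebra; see sem_hom and sem_unique. *)
Definition sem (K A : Type) (S : coalg K A) (s : S) : series K A :=
  fun w => out (foldl (@der K A S) s w).

Lemma sem_hom (K A : Type) (S : coalg K A) :
  is_hom (T := series_coalg K A) (@sem K A S).
Proof. by []. Qed.

Lemma sem_unique (K A : Type) (S : coalg K A) (f : S -> series K A) :
  is_hom (T := series_coalg K A) f -> forall s, f s =1 sem s.
Proof.
move=> [fo fd] s w; elim: w s => [|a w IHw] s; first exact: fo.
by rewrite -[RHS]/(sem (der s a) w) -IHw -fd.
Qed.

Section NCPoly.
Variables (K : pzSemiRingType) (X : choiceType).

Definition ncpoly := {fsfun seq X -> K with 0}.
HB.instance Definition _ := Choice.on ncpoly.
Implicit Types (p q r : ncpoly) (w : seq X) (k : K).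

Definition nczero : ncpoly := [fsfun with 0].

Definition ncadd p q : ncpoly :=
  [fsfun w in finsupp p `|` finsupp q => p w + q w | 0].

Definition ncscale k p : ncpoly := [fsfun w in finsupp p => k * p w | 0].

Definition ncword w : ncpoly := [fsfun v in [fset w] => 1 | 0].

Definition cauchy (f g : seq X -> K) w : K :=
  \sum_(i < (size w).+1) f (take i w) * g (drop i w).

Definition ncmul p q : ncpoly :=
  [fsfun w in [fset u ++ v | u in finsupp p, v in finsupp q]
     => cauchy p q w | 0].

Lemma ncpolyP p q : (p : seq X -> K) =1 q -> p = q.
Proof. by move/fsfunP. Qed.

Lemma nczeroE w : nczero w = 0.
Proof. by rewrite fsfunE. Qed.

Lemma ncaddE p q w : ncadd p q w = p w + q w.
Proof.
rewrite fsfunE in_fsetU; case: finsuppP => // _; case: finsuppP => //= _.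
by rewrite addr0.
Qed.

Lemma ncscaleE k p w : ncscale k p w = k * p w.
Proof. by rewrite fsfunE; case: finsuppP => // _; rewrite mulr0. Qed.

Lemma ncwordE w v : ncword w v = (v == w)%:R.
Proof. by rewrite fsfunE in_fset1; case: eqP. Qed.

Lemma ncmulE p q w : ncmul p q w = cauchy p q w.
Proof.
rewrite fsfunE; case: ifPn => // w_out; rewrite /cauchy big1 // => i _.
case: (finsuppP p) => [|pi]; first by rewrite mul0r.
case: (finsuppP q) => [|qi]; first by rewrite mulr0.
by case/negP: w_out; rewrite -(cat_take_drop i w); apply: in_imfset2.
Qed.

Lemma cauchy_nil f g : cauchy f g [::] = f [::] * g [::].
Proof. by rewrite /cauchy big_ord1. Qed.

Lemma cauchy_cons f g x w :
  cauchy f g (x :: w) = f [::] * g (x :: w) + cauchy (fun v => f (x :: v)) g w.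
Proof. by rewrite /cauchy big_ord_recl. Qed.

Lemma eq_cauchy f f' g g' : f =1 f' -> g =1 g' -> cauchy f g =1 cauchy f' g'.
Proof. by move=> ef eg w; apply: eq_bigr => i _; rewrite ef eg. Qed.

Lemma cauchyDl f f' g w :
  cauchy (fun v => f v + f' v) g w = cauchy f g w + cauchy f' g w.
Proof. by rewrite -big_split; apply: eq_bigr => i _; rewrite mulrDl. Qed.

Lemma cauchyDr f g g' w :
  cauchy f (fun v => g v + g' v) w = cauchy f g w + cauchy f g' w.
Proof. by rewrite -big_split; apply: eq_bigr => i _; rewrite mulrDr. Qed.

Lemma cauchyZl k f g w : cauchy (fun v => k * f v) g w = k * cauchy f g w.
Proof. by rewrite mulr_sumr; apply: eq_bigr => i _; rewrite mulrA. Qed.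

Lemma cauchyA f g h w :
  cauchy f (cauchy g h) w = cauchy (cauchy f g) h w.
Proof.
elim: w f g h => [|x w IHw] f g h; first by rewrite !cauchy_nil mulrA.
rewrite !cauchy_cons cauchy_nil mulrDr mulrA -addrA; congr (_ + _).
rewrite IHw -cauchyZl -cauchyDl.
by apply: eq_cauchy => // v; rewrite cauchy_cons.
Qed.

Lemma cauchy0l f w : cauchy (fun=> 0) f w = 0.
Proof. by rewrite /cauchy big1 // => i _; rewrite mul0r. Qed.

Lemma cauchy0r f w : cauchy f (fun=> 0) w = 0.
Proof. by rewrite /cauchy big1 // => i _; rewrite mulr0. Qed.

Lemma cauchy1l f w : cauchy (fun v => (v == [::])%:R) f w = f w.
Proof.
case: w => [|x w]; first by rewrite cauchy_nil mul1r.
by rewrite cauchy_cons /= mul1r cauchy0l addr0.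
Qed.

Lemma cauchy1r f w : cauchy f (fun v => (v == [::])%:R) w = f w.
Proof.
elim: w f => [|x w IHw] f; first by rewrite cauchy_nil mulr1.
by rewrite cauchy_cons /= mulr0 add0r IHw.
Qed.

Fact ncaddC : commutative ncadd.
Proof. by move=> p q; apply: ncpolyP => w; rewrite !ncaddE addrC. Qed.

Fact ncaddA : associative ncadd.
Proof. by move=> p q r; apply: ncpolyP => w; rewrite !ncaddE addrA. Qed.

Fact ncadd0 : left_id nczero ncadd.
Proof. by move=> p; apply: ncpolyP => w; rewrite ncaddE nczeroE add0r. Qed.

HB.instance Definition _ := GRing.isNmodule.Build ncpoly ncaddA ncaddC ncadd0.

Fact ncmulA : associative ncmul.
Proof.
move=> p q r; apply: ncpolyP => w; rewrite !ncmulE.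
rewrite (eq_cauchy (fun=> erefl) (ncmulE q r)) cauchyA.
by apply: eq_cauchy => // v; rewrite ncmulE.
Qed.

Fact ncmul1l : left_id (ncword [::]) ncmul.
Proof.
move=> p; apply: ncpolyP => w.
by rewrite ncmulE (eq_cauchy (ncwordE [::]) (fun=> erefl)) cauchy1l.
Qed.

Fact ncmul1r : right_id (ncword [::]) ncmul.
Proof.
move=> p; apply: ncpolyP => w.
by rewrite ncmulE (eq_cauchy (fun=> erefl) (ncwordE [::])) cauchy1r.
Qed.

Fact ncmulDl : left_distributive ncmul +%R.
Proof.
move=> p q r; apply: ncpolyP => w; rewrite ncaddE !ncmulE -cauchyDl.
by apply: eq_cauchy => // v; rewrite ncaddE.
Qed.

Fact ncmulDr : right_distributive ncmul +%R.
Proof.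
move=> p q r; apply: ncpolyP => w; rewrite ncaddE !ncmulE -cauchyDr.
by apply: eq_cauchy => // v; rewrite ncaddE.
Qed.

Fact ncmul0l : left_zero 0 ncmul.
Proof.
move=> p; apply: ncpolyP => w.
by rewrite ncmulE (eq_cauchy nczeroE (fun=> erefl)) cauchy0l nczeroE.
Qed.

Fact ncmul0r : right_zero 0 ncmul.
Proof.
move=> p; apply: ncpolyP => w.
by rewrite ncmulE (eq_cauchy (fun=> erefl) nczeroE) cauchy0r nczeroE.
Qed.

HB.instance Definition _ := GRing.Nmodule_isPzSemiRing.Build ncpoly
  ncmulA ncmul1l ncmul1r ncmulDl ncmulDr ncmul0l ncmul0r.

Fact ncscaleA k k' p : ncscale k (ncscale k' p) = ncscale (k * k') p.
Proof. by apply: ncpolyP => w; rewrite !ncscaleE mulrA. Qed.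

Fact ncscale0 p : ncscale 0 p = 0.
Proof. by apply: ncpolyP => w; rewrite ncscaleE nczeroE mul0r. Qed.

Fact ncscale1 : left_id 1 ncscale.
Proof. by move=> p; apply: ncpolyP => w; rewrite ncscaleE mul1r. Qed.

Fact ncscaleDr : right_distributive ncscale +%R.
Proof.
by move=> k p q; apply: ncpolyP => w; rewrite ncaddE !ncscaleE ncaddE mulrDr.
Qed.

Fact ncscaleDl p : {morph ncscale^~ p : k k' / k + k'}.
Proof.
by move=> k k'; apply: ncpolyP => w; rewrite ncaddE !ncscaleE mulrDl.
Qed.

HB.instance Definition _ := GRing.Nmodule_isLSemiModule.Build K ncpoly
  ncscaleA ncscale0 ncscale1 ncscaleDr ncscaleDl.

End NCPoly.

Section ContextFree.
Variables (K : comPzSemiRingType) (A X : finType).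
Variables (o : X -> K) (delta : X -> A -> ncpoly K X).

Fixpoint word_out (w : seq X) : K :=
  if w is x :: w' then o x * word_out w' else 1.

Fixpoint word_der (w : seq X) (a : A) : ncpoly K X :=
  if w is x :: w' then delta x a * ncword K w' + o x *: word_der w' a else 0.

Definition poly_coalg : coalg K A :=
  @Coalg K A (ncpoly K X)
    (fun p => \sum_(w <- finsupp p) p w * word_out w)
    (fun p a => \sum_(w <- finsupp p) p w *: word_der w a).

End ContextFree.

Definition context_free_series (K : comPzSemiRingType) (A : finType)
    (sigma : series K A) : Prop :=
  exists (X : finType) (o : X -> K) (delta : X -> A -> ncpoly K X)
         (p : poly_coalg o delta),
    sigma =1 sem p.

Record cfg (A : finType) := Cfg {
  nonterm : finType;
  start : nonterm;
  rules : seq (nonterm * seq (nonterm + A)) }.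

Definition cfg_step (A : finType) (G : cfg A)
    (s t : seq (nonterm G + A)) : Prop :=
  exists (u v : seq (nonterm G + A)) (r : nonterm G * seq (nonterm G + A)),
    [/\ r \in rules G, s = u ++ inl r.1 :: v & t = u ++ r.2 ++ v].

Definition cfg_generates (A : finType) (G : cfg A) (w : seq A) : Prop :=
  clos_refl_trans _ (@cfg_step A G) [:: inl (start G)] (map inr w).

Definition context_free_language (A : finType) (L : seq A -> Prop) : Prop :=
  exists G : cfg A, forall w, L w <-> cfg_generates G w.

(* The Boolean semiring: MathComp's own ring structure on bool is the field with
   two elements, whose addition is exclusive or, hence the separate name. *)
Definition boolean : Type := bool.
HB.instance Definition _ := Choice.copy boolean bool.
HB.instance Definition _ :=
  GRing.isNmodule.Build boolean orbA orbC orFb.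
HB.instance Definition _ :=
  GRing.Nmodule_isComPzSemiRing.Build boolean andbA andbC andTb andb_orl andFb.

Inductive muexp (K A : Type) :=
| Const of K
| Var of nat
| Letter of A
| Add of muexp K A & muexp K A
| Mul of muexp K A & muexp K A
| Mu of nat & muexp K A.

Arguments Const {K A} _.
Arguments Var {K A} _.
Arguments Letter {K A} _.

(* The mutual grammar t ::= k | x | a | t + t | t x t | mu x.g and
   g ::= a x t | k | g + g is rendered by the predicates wf for t and
   guarded, together with wf, for g. *)
Fixpoint guarded (K A : Type) (t : muexp K A) : bool :=
  match t with
  | Const _ => true
  | Mul (Letter _) _ => true
  | Add u v => guarded u && guarded v
  | _ => false
  end.

Fixpoint wf (K A : Type) (t : muexp K A) : bool :=
  match t with
  | Add u v | Mul u v => wf u && wf v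
  | Mu _ u => guarded u && wf u
  | _ => true
  end.

Fixpoint fv (K A : Type) (t : muexp K A) : seq nat :=
  match t with
  | Var x => [:: x]
  | Add u v | Mul u v => fv u ++ fv v
  | Mu x u => [seq y <- fv u | y != x]
  | _ => [::]
  end.

Definition is_closed (K A : Type) (t : muexp K A) : bool := nilp (fv t).

(* t[s/x]; it is only used with s closed, so no bound variable is renamed. *)
Fixpoint subst (K A : Type) (x : nat) (s t : muexp K A) : muexp K A :=
  match t with
  | Var y => if y == x then s else t
  | Add u v => Add (subst x s u) (subst x s v)
  | Mul u v => Mul (subst x s u) (subst x s v)
  | Mu y u => if y == x then t else Mu y (subst x s u)
  | _ => t
  end.

Section MuCoalg.
Variables (K : comPzSemiRingType) (A : finType).
Implicit Types (t u v s : muexp K A) (a b : A).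

(* The values at a mu are those of the unfolded body, see mu_out_Mu and
   mu_der_Mu; they are written so that the recursion is structural.  The values
   at a variable are irrelevant for closed terms. *)
Fixpoint mu_out t : K :=
  match t with
  | Const k => k
  | Var _ => 0
  | Letter _ => 0
  | Add u v => mu_out u + mu_out v
  | Mul u v => mu_out u * mu_out v
  | Mu _ u => mu_out u
  end.

(* The clause (u x v)_a = u_a x v + o(u) x v_a is not well-founded for u a
   letter: with s = mu x.(b x x), it would ask for a finite term s_a of the form
   (b_a x s) + (0 x s_a).  When u is a letter, and only then, the summand
   0 x v_a is therefore left out; it denotes the zero series, so the clause
   still holds up to the semantics, see term_sem_der_Mul. *)
Fixpoint mu_der t a : muexp K A :=
  match t with
  | Const _ => Const 0
  | Var _ => Const 0
  | Letter b => if b == a then Const 1 else Const 0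
  | Add u v => Add (mu_der u a) (mu_der v a)
  | Mul u v =>
      if u is Letter _ then Mul (mu_der u a) v
      else Add (Mul (mu_der u a) v) (Mul (Const (mu_out u)) (mu_der v a))
  | Mu x u => subst x t (mu_der u a)
  end.

Lemma mu_out_subst x s u : guarded u -> mu_out (subst x s u) = mu_out u.
Proof.
elim: u => //= [u IHu v IHv /andP[/IHu-> /IHv->] // | u _ v _].
by case: u => //= b _; rewrite !mul0r.
Qed.

Lemma mu_der_subst x s u a :
  guarded u -> mu_der (subst x s u) a = subst x s (mu_der u a).
Proof.
elim: u => //= [u IHu v IHv /andP[/IHu-> /IHv->] // | u _ v _].
by case: u => //= b _; case: ifP.
Qed.

Lemma mu_out_Mu x u :
  guarded u -> mu_out (Mu x u) = mu_out (subst x (Mu x u) u).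
Proof. by move=> gu; rewrite mu_out_subst. Qed.

Lemma mu_der_Mu x u a :
  guarded u -> mu_der (Mu x u) a = mu_der (subst x (Mu x u) u) a.
Proof. by move=> gu; rewrite mu_der_subst. Qed.

Lemma subst_guarded x s t : guarded t -> guarded (subst x s t).
Proof.
elim: t => //= [u IHu v IHv /andP[gu gv] | u _ v _]; first by rewrite IHu ?IHv.
by case: u.
Qed.

Lemma subst_wf x s t : wf s -> wf t -> wf (subst x s t).
Proof.
move=> ws; elim: t => //= [y _|u IHu v IHv|u IHu v IHv|y u IHu].
- by case: ifP.
- by case/andP=> /IHu-> /IHv->.
- by case/andP=> /IHu-> /IHv->.
case/andP=> gu wu; case: ifP => _ /=; first by rewrite gu.
by rewrite subst_guarded // IHu.
Qed.

Lemma fv_subst x s t :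
  {subset fv (subst x s t) <= fv s ++ [seq y <- fv t | y != x]}.
Proof.
elim: t => //= [y|u IHu v IHv|u IHu v IHv|y u IHu] z.
- case: (eqVneq y x) => [->|yx] /=; first by rewrite cats0.
  by rewrite mem_cat orbC inE => ->.
- by rewrite filter_cat !mem_cat => /orP[/IHu|/IHv]; rewrite mem_cat;
    case/orP=> -> //; rewrite ?orbT.
- by rewrite filter_cat !mem_cat => /orP[/IHu|/IHv]; rewrite mem_cat;
    case/orP=> -> //; rewrite ?orbT.
case: (eqVneq y x) => [->|yx] /=.
  by rewrite mem_cat !mem_filter => /andP[-> ->]; rewrite orbT.
rewrite mem_filter => /andP[zy /IHu]; rewrite !mem_cat !mem_filter.
by case/orP=> [->//|/andP[-> ->]]; rewrite zy orbT.
Qed.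

Lemma mu_der_wf t a : wf t -> wf (mu_der t a).
Proof.
elim: t => //= [b _|u IHu v IHv|u IHu v IHv|x u IHu].
- by case: ifP.
- by case/andP=> /IHu-> /IHv->.
- case/andP=> wu wv; move: (IHu wu) (IHv wv) => wu' wv'.
  suff: wf (Add (Mul (mu_der u a) v) (Mul (Const (mu_out u)) (mu_der v a))).
    by case: u {IHu wu wu'} => // b /andP[].
  by rewrite /= wu' wv wv'.
by case/andP=> gu wu; rewrite subst_wf ?IHu //= gu.
Qed.

Lemma fv_mu_der t a : {subset fv (mu_der t a) <= fv t}.
Proof.
elim: t => //= [b|u IHu v IHv|u IHu v IHv|x u IHu] z.
- by case: ifP.
- by rewrite !mem_cat => /orP[/IHu->//|/IHv->]; rewrite orbT.
- suff: z \in fv (mu_der u a) ++ fv v ++ fv (mu_der v a) -> z \in fv u ++ fv v.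
    move=> H zd; apply: H; move: zd.
    by case: u {IHu} => *; rewrite // ?catA // mem_cat; apply/orP; left.
  by rewrite !mem_cat => /or3P[/IHu->//|->|/IHv->]; rewrite orbT.
move/fv_subst; rewrite mem_cat => /orP[//|].
by rewrite !mem_filter => /andP[-> /IHu].
Qed.

Lemma mu_der_closed t a :
  wf t && is_closed t -> wf (mu_der t a) && is_closed (mu_der t a).
Proof.
case/andP=> wt /nilP fvt; rewrite mu_der_wf //=.
apply/nilP; have := @fv_mu_der t a; rewrite fvt.
by case: (fv _) => // y l sub; have := sub y (mem_head _ _).
Qed.

Record closed_muexp := ClosedMuexp {
  muval :> muexp K A;
  muvalP : wf muval && is_closed muval }.

Definition mu_coalg : coalg K A :=
  @Coalg K A closed_muexp
    (fun t : closed_muexp => mu_out t)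
    (fun (t : closed_muexp) a => ClosedMuexp (mu_der_closed a (muvalP t))).

Definition mu_sem (t : closed_muexp) : series K A := sem (t : mu_coalg).

Definition term_sem t (w : seq A) : K := mu_out (foldl mu_der t w).

Lemma mu_semE (t : closed_muexp) w : mu_sem t w = term_sem t w.
Proof.
rewrite /mu_sem; elim: w t => [|a w IHw] t //.
by rewrite -[LHS]/(mu_sem (der (t : mu_coalg) a) w) /mu_sem IHw.
Qed.

Lemma term_sem_Add u v w : term_sem (Add u v) w = term_sem u w + term_sem v w.
Proof. by elim: w u v => [|a w IHw] u v //; apply: IHw. Qed.

Lemma term_sem_Mul0 v w : term_sem (Mul (Const 0) v) w = 0.
Proof.
elim: w v => [|a w IHw] v; first exact: mul0r.
rewrite -[LHS]/(term_sem (Add (Mul _ v) (Mul _ (mu_der v a))) w).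
by rewrite term_sem_Add !IHw addr0.
Qed.

Lemma term_sem_der_Mul u v a :
  term_sem (mu_der (Mul u v) a) =1
  term_sem (Add (Mul (mu_der u a) v) (Mul (Const (mu_out u)) (mu_der v a))).
Proof. by case: u => // b w; rewrite term_sem_Add term_sem_Mul0 addr0. Qed.

End MuCoalg.

(* Main.v *)
(* The terms mu x.u met while unfolding a closed term t form a finite list L,
   obtained by closing each mu-subterm of t with the fixed points that surround
   it. Take A + L as set of indeterminates. A term whose maximal mu-subterms
   all lie in L is read as a noncommutative polynomial, and the derivatives of
   such a term are again of this kind, because every fixed
   point in L unfolds to a guarded term of this kind. Since output and
   derivative on K<X> obey the same sum and product rules as on terms, this
   reading is a bisimulation. Over the Booleans, the supports of the derivatives
   of the indeterminates are the rules of a grammar in Greibach form. *)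
Require Import Defs.
From Stdlib Require Import Relations List.
From mathcomp Require Import all_boot all_order all_algebra finmap.

Set Implicit Arguments.
Unset Strict Implicit.
Unset Printing Implicit Defensive.

Import GRing.Theory Defs.
Local Open Scope fset_scope.
Local Open Scope ring_scope.

(** * Noncommutative polynomials *)

Section LinearExtension.
Variables (K : comPzSemiRingType) (X : choiceType).
Implicit Types (p q : ncpoly K X) (w : seq X) (k : K).

Lemma ncaddrE p q w : (p + q) w = p w + q w.
Proof. exact: ncaddE. Qed.

Lemma ncscalerE k p w : (k *: p) w = k * p w.
Proof. exact: ncscaleE. Qed.

Lemma ncscaleAl k p q : (k *: p) * q = k *: (p * q).
Proof.
apply: ncpolyP => w; rewrite ncscalerE !ncmulE -cauchyZl.
by apply: eq_cauchy => // v; rewrite ncscalerE.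
Qed.

Lemma ncscaleAr k p q : p * (k *: q) = k *: (p * q).
Proof.
apply: ncpolyP => w; rewrite ncscalerE !ncmulE mulr_sumr.
by apply: eq_bigr => i _; rewrite ncscalerE mulrCA.
Qed.

Lemma ncwordM (u v : seq X) : ncword K u * ncword K v = ncword K (u ++ v).
Proof.
apply: ncpolyP => w; rewrite ncmulE ncwordE.
rewrite (eq_cauchy (ncwordE K u) (ncwordE K v)).
elim: u w => [|x u IHu] [|y w].
- by rewrite cauchy1l.
- by rewrite cauchy1l.
- by rewrite cauchy_nil mul0r.
rewrite cauchy_cons mul0r add0r cat_cons eqseq_cons.
have [->|yx] /= := eqVneq y x.
  by rewrite -IHu; apply: eq_cauchy => // t; rewrite eqseq_cons eqxx.
rewrite -[RHS](cauchy0l (fun t => (t == v)%:R) w); apply: eq_cauchy => // t.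
by rewrite eqseq_cons (negPf yx).
Qed.

Section LinExt.
Variables (M : lSemiModType K) (f : seq X -> M).

(** Both maps of [poly_coalg] are instances up to conversion, the output with [M := K^o] and the
    derivative with polynomials as [M], so linearity is proved once. *)
Definition linext p : M := \sum_(w <- finsupp p) p w *: f w.

(** Polynomials with different supports can thus be summed over one common index set. *)
Lemma linextE (S : {fset seq X}) p :
  finsupp p `<=` S -> linext p = \sum_(w <- S) p w *: f w.
Proof.
move=> sub; rewrite /linext; apply: big_fset_incl => // w _ w_out.
by rewrite fsfun_dflt // scale0r.
Qed.

Lemma linextD p q : linext (p + q) = linext p + linext q.
Proof.
pose S := finsupp p `|` finsupp q `|` finsupp (p + q).
rewrite !(@linextE S);
  try by apply/fsubsetP => w wp; rewrite !in_fsetU wp ?orbT.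
by rewrite -big_split; apply: eq_bigr => w _; rewrite ncaddrE scalerDl.
Qed.

Lemma linext0 : linext 0 = 0.
Proof. by rewrite /linext big1 // => w _; rewrite nczeroE scale0r. Qed.

Lemma linextZ k p : linext (k *: p) = k *: linext p.
Proof.
pose S := finsupp p `|` finsupp (k *: p).
rewrite !(@linextE S) /S ?fsubsetUl ?fsubsetUr // scaler_sumr.
by apply: eq_bigr => w _; rewrite ncscalerE scalerA.
Qed.

Lemma linext_word w : linext (ncword K w) = f w.
Proof.
rewrite (@linextE [fset w]).
  by rewrite big_seq_fset1 ncwordE eqxx scale1r.
apply/fsubsetP => v; rewrite mem_finsupp ncwordE inE.
by case: (v == w); rewrite //= eqxx.
Qed.

End LinExt.

Lemma ncpoly_expand p : p = linext (@ncword K X) p.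
Proof.
have evalS (s : seq (seq X)) (g : seq X -> ncpoly K X) w :
    (\sum_(v <- s) g v) w = \sum_(v <- s) g v w.
  by elim: s => [|v s IHs]; rewrite ?big_nil ?nczeroE // !big_cons ncaddrE IHs.
(* Adding [w] to the index set lets its term be split off even when [w] lies outside the support. *)
apply: ncpolyP => w; rewrite (@linextE _ _ (w |` finsupp p)) ?fsubsetUr //.
rewrite evalS (big_fsetD1 w) ?fset1U1 //= ncscalerE ncwordE eqxx mulr1.
rewrite big_seq big1 ?addr0 // => v; rewrite !inE => /andP[vw _].
by rewrite ncscalerE ncwordE eq_sym (negPf vw) mulr0.
Qed.

Lemma ncpoly_ind (P : ncpoly K X -> Prop) :
  P 0 -> (forall p q, P p -> P q -> P (p + q)) ->
  (forall k w, P (k *: ncword K w)) -> forall p, P p.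
Proof.
move=> P0 PD PZ p; rewrite [p]ncpoly_expand /linext.
by elim: (enum_fset _) => [|w s IHs]; rewrite ?big_nil // big_cons; apply: PD.
Qed.

End LinearExtension.

(** * Sum and product rules in the coalgebra of polynomials *)

Section PolyCoalgebra.
Variables (K : comPzSemiRingType) (A X : finType).
Variables (o : X -> K) (delta : X -> A -> ncpoly K X).
Implicit Types (p q : ncpoly K X) (a : A) (k : K) (w : seq A).

Definition poly_out p : K := out (p : poly_coalg o delta).
Definition poly_der p a : ncpoly K X := der (p : poly_coalg o delta) a.
Definition poly_sem p : series K A := sem (p : poly_coalg o delta).

Lemma poly_out0 : poly_out 0 = 0.
Proof. exact: (linext0 (word_out o : seq X -> K^o)). Qed.

Lemma poly_outD p q : poly_out (p + q) = poly_out p + poly_out q.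
Proof. exact: (linextD (word_out o : seq X -> K^o)). Qed.

Lemma poly_outZ k p : poly_out (k *: p) = k * poly_out p.
Proof. exact: (linextZ (word_out o : seq X -> K^o)). Qed.

Lemma poly_out_word v : poly_out (ncword K v) = word_out o v.
Proof. exact: (linext_word (word_out o : seq X -> K^o)). Qed.

Lemma poly_der0 a : poly_der 0 a = 0.
Proof. exact: (linext0 (word_der o delta ^~ a)). Qed.

Lemma poly_derD p q a : poly_der (p + q) a = poly_der p a + poly_der q a.
Proof. exact: (linextD (word_der o delta ^~ a)). Qed.

Lemma poly_derZ k p a : poly_der (k *: p) a = k *: poly_der p a.
Proof. exact: (linextZ (word_der o delta ^~ a)). Qed.

Lemma poly_der_word v a : poly_der (ncword K v) a = word_der o delta v a.
Proof. exact: (linext_word (word_der o delta ^~ a)). Qed.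

Lemma word_out_cat u v : word_out o (u ++ v) = word_out o u * word_out o v.
Proof. by elim: u => [|x u IHu] /=; rewrite ?mul1r // IHu mulrA. Qed.

Lemma word_der_cat u v a :
  word_der o delta (u ++ v) a =
  word_der o delta u a * ncword K v + word_out o u *: word_der o delta v a.
Proof.
elim: u => [|x u IHu] /=; first by rewrite mul0r add0r scale1r.
by rewrite IHu mulrDl -mulrA ncwordM ncscaleAl scalerDr scalerA addrA.
Qed.

Lemma poly_outM p q : poly_out (p * q) = poly_out p * poly_out q.
Proof.
elim/ncpoly_ind: p => [|p1 p2 IH1 IH2|k u].
- by rewrite mul0r poly_out0 mul0r.
- by rewrite mulrDl !poly_outD IH1 IH2 mulrDl.
elim/ncpoly_ind: q => [|q1 q2 IH1 IH2|l v].
- by rewrite mulr0 poly_out0 mulr0.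
- by rewrite mulrDr !poly_outD IH1 IH2 mulrDr.
rewrite ncscaleAl ncscaleAr ncwordM !poly_outZ !poly_out_word word_out_cat.
by rewrite -!mulrA [l * (word_out o u * _)]mulrCA.
Qed.

(** This matches the clause of [mu_der] for products. Both sides are bilinear, so scaled words
    suffice, and there it is [word_der_cat]; commutativity of [K] moves scalars past words. *)
Lemma poly_derM p q a :
  poly_der (p * q) a = poly_der p a * q + poly_out p *: poly_der q a.
Proof.
elim/ncpoly_ind: p => [|p1 p2 IH1 IH2|k u].
- by rewrite mul0r poly_der0 mul0r add0r poly_out0 scale0r.
- by rewrite mulrDl !poly_derD IH1 IH2 poly_outD scalerDl mulrDl addrACA.
elim/ncpoly_ind: q => [|q1 q2 IH1 IH2|l v].
- by rewrite mulr0 poly_der0 mulr0 scaler0 addr0.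
- by rewrite mulrDr !poly_derD IH1 IH2 scalerDr mulrDr addrACA.
rewrite !(ncscaleAl, ncscaleAr, poly_derZ, poly_outZ) ncwordM.
rewrite !poly_der_word !poly_out_word word_der_cat !scalerDr !scalerA.
by rewrite [l * k]mulrC mulrAC.
Qed.

Lemma poly_sem_nil p : poly_sem p [::] = poly_out p.
Proof. by []. Qed.

Lemma poly_sem_cons p a w : poly_sem p (a :: w) = poly_sem (poly_der p a) w.
Proof. by []. Qed.

Lemma poly_sem0 w : poly_sem 0 w = 0.
Proof.
by elim: w => [|a w]; [apply: poly_out0|rewrite poly_sem_cons poly_der0].
Qed.

Lemma poly_semD p q w : poly_sem (p + q) w = poly_sem p w + poly_sem q w.
Proof.
elim: w p q => [|a w IHw] p q; first exact: poly_outD.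
by rewrite !poly_sem_cons poly_derD IHw.
Qed.

Lemma poly_semZ k p w : poly_sem (k *: p) w = k * poly_sem p w.
Proof.
elim: w p => [|a w IHw] p; first exact: poly_outZ.
by rewrite !poly_sem_cons poly_derZ IHw.
Qed.

End PolyCoalgebra.

(** * From mu-expressions to polynomials *)

Section Translation.
Variables (K : comPzSemiRingType) (A : finType).
Implicit Types (t u v m : muexp K A) (L : seq (muexp K A)) (a b : A).

(** The test stops at each [Mu], so any variable it meets is free and is rejected. *)
Fixpoint built L t : Prop :=
  match t with
  | Const _ | Letter _ => True
  | Var _ => False
  | Add u v | Mul u v => built L u /\ built L v
  | Mu _ _ => In t L
  end.

Definition unfolds L m : Prop :=
  exists x u, [/\ m = Mu x u, guarded u & built L (subst x m u)].

Lemma built_incl L L' t : incl L L' -> built L t -> built L' t.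
Proof.
move=> LL'; elim: t => //= [u IHu v IHv|u IHu v IHv|x u _].
- by case=> /IHu ? /IHv.
- by case=> /IHu ? /IHv.
exact: LL'.
Qed.

Lemma unfolds_incl L L' m : incl L L' -> unfolds L m -> unfolds L' m.
Proof.
move=> LL' [x [u [-> gu bu]]]; exists x, u; split=> //.
exact: built_incl bu.
Qed.

Definition upd (e : nat -> option (muexp K A)) x o :
    nat -> option (muexp K A) :=
  fun y => if y == x then o else e y.

(* Only used when the values of e are closed, so that nothing is captured. *)
Fixpoint ssubst (e : nat -> option (muexp K A)) t : muexp K A :=
  match t with
  | Var x => odflt t (e x)
  | Add u v => Add (ssubst e u) (ssubst e v)
  | Mul u v => Mul (ssubst e u) (ssubst e v)
  | Mu x u => Mu x (ssubst (upd e x None) u)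
  | _ => t
  end.

Lemma ssubst_guarded e t : guarded t -> guarded (ssubst e t).
Proof.
elim: t => //= [u IHu v IHv /andP[gu gv] | u _ v _]; first by rewrite IHu ?IHv.
by case: u.
Qed.

Lemma eq_ssubst e e' t :
  (forall x, x \in fv t -> e x = e' x) -> ssubst e t = ssubst e' t.
Proof.
elim: t e e' => //= [x|u IHu v IHv|u IHu v IHv|x u IHu] e e' ee'.
- by rewrite ee' ?mem_head.
- by congr Add; [apply: IHu|apply: IHv] => y yfv;
    apply: ee'; rewrite mem_cat yfv ?orbT.
- by congr Mul; [apply: IHu|apply: IHv] => y yfv;
    apply: ee'; rewrite mem_cat yfv ?orbT.
congr Mu; apply: IHu => y yfv; rewrite /upd; case: eqP => // /eqP yx.
by apply: ee'; rewrite mem_filter yx.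
Qed.

Lemma ssubst_none t : ssubst (fun=> None) t = t.
Proof.
elim: t => //= [u -> v ->|u -> v ->|x u IHu] //.
by congr Mu; rewrite -[RHS]IHu; apply: eq_ssubst => y _; rewrite /upd if_same.
Qed.

Lemma subst_notin x m t : x \notin fv t -> subst x m t = t.
Proof.
elim: t => //= [y|u IHu v IHv|u IHu v IHv|y u IHu].
- by rewrite inE eq_sym => /negPf->.
- by rewrite mem_cat negb_or => /andP[/IHu-> /IHv->].
- by rewrite mem_cat negb_or => /andP[/IHu-> /IHv->].
rewrite mem_filter negb_and negbK eq_sym.
by case: eqP => //= _ /IHu->.
Qed.

(** Closing a body under its binder and then unfolding amounts to one simultaneous substitution. The
    values of [e] are closed, so the later substitution leaves them alone. *)
Lemma subst_ssubst e x m t :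
  (forall y s, e y = Some s -> is_closed s) ->
  subst x m (ssubst (upd e x None) t) = ssubst (upd e x (Some m)) t.
Proof.
elim: t e => //= [y|u IHu v IHv|u IHu v IHv|y u IHu] e ce.
- rewrite /upd; have [->|yx] /= := eqVneq y x; first by rewrite eqxx.
  case ey: (e y) => [s|] /=; last by rewrite (negPf yx).
  by rewrite subst_notin // (nilP (ce _ _ ey)).
- by rewrite IHu ?IHv.
- by rewrite IHu ?IHv.
(* An inner binder of the same name shadows [x], so neither side replaces it below; distinct names
   give updates that commute. *)
have [->|yx] := eqVneq y x.
  by congr Mu; apply: eq_ssubst => z _; rewrite /upd; case: (z == x).
have updC o : upd (upd e x o) y None =1 upd (upd e y None) x o.
  by move=> z; rewrite /upd; have [->|//] := eqVneq z y; rewrite (negPf yx).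
rewrite (@eq_ssubst (upd (upd e x None) y None) _ u (fun z _ => updC _ z)).
rewrite IHu => [|z s]; last by rewrite /upd; case: eqP => // _; apply: ce.
by congr Mu; apply: eq_ssubst => z _; rewrite updC.
Qed.

Lemma fv_ssubst e t :
  (forall x s, e x = Some s -> is_closed s) ->
  {subset fv (ssubst e t) <= [seq x <- fv t | ~~ e x]}.
Proof.
elim: t e => //= [x|u IHu v IHv|u IHu v IHv|x u IHu] e ce z.
- by case ex: (e x) => [s|] //=; rewrite (nilP (ce _ _ ex)).
- by rewrite filter_cat !mem_cat => /orP[/IHu->|/IHv->]; rewrite ?orbT.
- by rewrite filter_cat !mem_cat => /orP[/IHu->|/IHv->]; rewrite ?orbT.
rewrite mem_filter => /andP[zx /IHu].
rewrite !mem_filter /upd (negPf zx) => -> //=.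
by move=> y s; case: eqP => // _; apply: ce.
Qed.

(* Members of L0 are promised to unfold in the end; this is what lets the
   induction enter a body mu x.u with the fixed point itself already listed. *)
Lemma ssubst_built t e L0 :
  wf t -> (forall x s, e x = Some s -> is_closed s) ->
  (forall x, x \in fv t -> exists2 s, e x = Some s & built L0 s) ->
  exists L, [/\ incl L0 L, built L (ssubst e t) &
                forall m, In m L -> In m L0 \/ unfolds L m].
Proof.
(* The list grows from [L1] to [L2] while [u] is processed; [good_trans] threads it through the two
   operands of a sum or product. *)
pose good f L1 u L2 := [/\ incl L1 L2, built L2 (ssubst f u) &
                       forall m, In m L2 -> In m L1 \/ unfolds L2 m].
have good_trans f L1 L2 L3 u v : good f L1 u L2 -> good f L2 v L3 ->
    [/\ incl L1 L3, built L3 (ssubst f u) /\ built L3 (ssubst f v) &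
        forall m, In m L3 -> In m L1 \/ unfolds L3 m].
  case=> inc2 b2 unf2 [inc3 b3 unf3]; split; first exact: incl_tran inc3.
    by split=> //; apply: built_incl b2.
  move=> m /unf3[/unf2[]|]; [by left| |by right].
  by move/(unfolds_incl inc3); right.
elim: t e L0 => [k|x|b|u IHu v IHv|u IHu v IHv|x u IHu] e L0 /= wt ce be.
- by exists L0; split=> //; left.
- have [s -> bs] := be x (mem_head _ _).
  by exists L0; split=> //; left.
- by exists L0; split=> //; left.
- case/andP: wt => wu wv.
  have [|L1 good1] := IHu e L0 wu ce.
    by move=> y yu; apply: be; rewrite mem_cat yu.
  have [|L2 good2] := IHv e L1 wv ce; last first.
    by exists L2; apply: good_trans good1 good2.
  move=> y yv; have [|s es bs] := be y; first by rewrite mem_cat yv orbT.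
  by exists s => //; case: good1 => inc1 _ _; apply: built_incl bs.
- case/andP: wt => wu wv.
  have [|L1 good1] := IHu e L0 wu ce.
    by move=> y yu; apply: be; rewrite mem_cat yu.
  have [|L2 good2] := IHv e L1 wv ce; last first.
    by exists L2; apply: good_trans good1 good2.
  move=> y yv; have [|s es bs] := be y; first by rewrite mem_cat yv orbT.
  by exists s => //; case: good1 => inc1 _ _; apply: built_incl bs.
case/andP: wt => gu wu; set m := Mu x _.
have cm : is_closed m.
  rewrite /is_closed -[m]/(ssubst e (Mu x u)).
  case fvm: (fv _) => [//|y l]; have := @fv_ssubst e (Mu x u) ce y.
  rewrite fvm mem_head mem_filter => /(_ isT)/andP[eyN yfv].
  by case: (be y yfv) eyN => s ->.
have [||L [inc bu unf]] := IHu (upd e x (Some m)) (m :: L0) wu.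
- by move=> y s; rewrite /upd; case: eqP => [_ [<-] //|_]; apply: ce.
- move=> y yu; rewrite /upd; case: eqP => [_|/eqP yx].
    by exists m => //; left.
  have [|s es bs] := be y; first by rewrite mem_filter yx.
  by exists s => //; apply: built_incl bs; apply: incl_tl.
have [inm inL0] := incl_cons_inv inc.
exists L; split=> // m' /unf[[<-|]|]; [right|by left|by right].
(* Here the promise for [m] is kept: by [subst_ssubst] its unfolding is the body just built over
   [L]. *)
exists x, (ssubst (upd e x None) u); split=> //; first exact: ssubst_guarded.
by rewrite subst_ssubst.
Qed.

(** Starting from the empty list leaves no promise open, so every member of the final list
    unfolds. *)
Lemma built_closed t :
  wf t -> is_closed t ->
  exists L, built L t /\ forall m, In m L -> unfolds L m.
Proof.
move=> wt /nilP ct.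
have [//||L [_ bt unf]] := @ssubst_built t (fun=> None) [::] wt.
  by rewrite ct.
exists L; split; first by rewrite ssubst_none in bt.
by move=> m /unf[].
Qed.

(** * The bisimulation between terms and polynomials *)

Section Represent.
Variables (n : nat) (tau : 'I_n -> muexp K A).

Let X : finType := (A + 'I_n)%type.

(** A relation is used because free variables have no reading, and a fixed point listed twice has
    two indeterminates. *)
Inductive represents : muexp K A -> ncpoly K X -> Prop :=
| rep_Const k : represents (Const k) (k *: ncword K [::])
| rep_Letter b : represents (Letter b) (ncword K [:: inl b])
| rep_Add u v p q :
    represents u p -> represents v q -> represents (Add u v) (p + q)
| rep_Mul u v p q :
    represents u p -> represents v q -> represents (Mul u v) (p * q)
| rep_Mu x u i : tau i = Mu x u -> represents (Mu x u) (ncword K [:: inr i]).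

Variable delta_mu : 'I_n -> A -> ncpoly K X.
Hypothesis delta_mu_rep : forall i a,
  represents (mu_der (tau i) a) (delta_mu i a).

Definition rep_o (x : X) : K := if x is inr i then mu_out (tau i) else 0.

Definition rep_delta (x : X) (a : A) : ncpoly K X :=
  match x with
  | inl b => (b == a)%:R *: ncword K [::]
  | inr i => delta_mu i a
  end.

Lemma represents_out t p :
  represents t p -> poly_out rep_o rep_delta p = mu_out t.
Proof.
elim=> [k|b|u v p' q _ IHu _ IHv|u v p' q _ IHu _ IHv|x u i def_i] /=.
- by rewrite poly_outZ poly_out_word mulr1.
- by rewrite poly_out_word /= mul0r.
- by rewrite poly_outD IHu IHv.
- by rewrite poly_outM IHu IHv.
by rewrite poly_out_word /= def_i mulr1.
Qed.

(* At a Letter factor mu_der drops the summand 0 x v_a; in K<X> it is 0. *)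
Lemma represents_der t p a :
  represents t p -> represents (mu_der t a) (poly_der rep_o rep_delta p a).
Proof.
elim=> [k|b|u v p' q _ IHu _ IHv|u v p' q ru IHu rv IHv|x u i def_i] /=.
- rewrite poly_derZ poly_der_word scaler0.
  rewrite -(scale0r (ncword K [::] : ncpoly K X)); exact: rep_Const.
- rewrite poly_der_word /= scale0r addr0 -[ncword _ _]/1 mulr1.
  by case: (b == a); apply: rep_Const.
- by rewrite poly_derD; apply: rep_Add.
- rewrite poly_derM (represents_out ru).
  have rsum : represents
      (Add (Mul (mu_der u a) v) (Mul (Const (mu_out u)) (mu_der v a)))
      (poly_der rep_o rep_delta p' a * q
       + mu_out u *: poly_der rep_o rep_delta q a).
    (* No rule of [represents] covers scaling, so the scalar becomes a left factor [k *: 1], the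
       reading of [Const k]. *)
    rewrite -[poly_der _ _ q a in X in _ + X]mul1r -ncscaleAl.
    by apply: rep_Add; apply: rep_Mul => //; apply: rep_Const.
  case: u ru IHu rsum => // b _ IHu _.
  by rewrite scale0r addr0; apply: rep_Mul.
rewrite poly_der_word /= scaler0 addr0 -[ncword _ _]/1 mulr1.
by have := delta_mu_rep i a; rewrite def_i.
Qed.

Lemma represents_sem t p w :
  represents t p -> term_sem t w = poly_sem rep_o rep_delta p w.
Proof.
elim: w t p => [|a w IHw] t p rtp.
  by rewrite poly_sem_nil (represents_out rtp).
exact: IHw (represents_der a rtp).
Qed.

End Represent.

(** With [m] itself as default no other element is needed; the index is in range, so the default can
    be changed afterwards. *)
Lemma nth_In L m : In m L -> exists i : 'I_(size L), seq.nth m L i = m.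
Proof.
elim: L => //= m' L IHL [->|/IHL[i Li]]; first by exists ord0.
by exists (lift ord0 i).
Qed.

Lemma In_nth L d i : (i < size L)%N -> In (seq.nth d L i) L.
Proof. by elim: L i => [|m L IHL] [|i] //= => [_|/IHL]; [left|right]. Qed.

Lemma built_represents L d t :
  built L t -> exists p, represents (fun i : 'I_(size L) => seq.nth d L i) t p.
Proof.
elim: t => //= [k _|b _|u IHu v IHv|u IHu v IHv|x u _].
- by exists (k *: ncword K [::]); apply: rep_Const.
- by eexists; apply: rep_Letter.
- by case=> /IHu[p rp] /IHv[q rq]; exists (p + q); apply: rep_Add.
- by case=> /IHu[p rp] /IHv[q rq]; exists (p * q); apply: rep_Mul.
case/nth_In=> i Li; exists (ncword K [:: inr i]). apply: rep_Mu.
by rewrite (set_nth_default (Mu x u)).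
Qed.

(** In a guarded term every product has a letter on the left, so the derivative copies the right
    factor unchanged and creates no new fixed point. *)
Lemma mu_der_guarded_built L u a :
  guarded u -> built L u -> built L (mu_der u a).
Proof.
elim: u => //= [u IHu v IHv /andP[gu gv] [bu bv]|u _ v _].
  by split; [apply: IHu|apply: IHv].
by case: u => //= b _ [_ bv]; case: (b == a).
Qed.

Theorem mu_sem_context_free (t : closed_muexp K A) :
  context_free_series (mu_sem t).
Proof.
have /andP[wt ct] := muvalP t.
have [L [bt unfL]] := built_closed wt ct.
pose tau (i : 'I_(size L)) := seq.nth (t : muexp K A) L i.
have rep_der i : exists d : A -> ncpoly K (A + 'I_(size L))%type,
    forall a, represents tau (mu_der (tau i) a) (d a).
  (* Letters and indices range over finite types, so the derivatives of the indeterminates are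
     chosen without any axiom of choice. *)
  apply: (@fin_all_exists A (fun=> ncpoly K (A + 'I_(size L))%type)
            (fun a => represents tau (mu_der (tau i) a))) => a.
  apply: built_represents.
  have [|x [u [def_u gu bu]]] := unfL (tau i).
    exact: In_nth.
  rewrite def_u mu_der_Mu //; apply: mu_der_guarded_built.
    exact: subst_guarded.
  by rewrite -def_u.
have [delta_mu rep_delta_mu] := fin_all_exists rep_der.
have [p rp] := built_represents (t : muexp K A) bt.
exists (A + 'I_(size L))%type, (rep_o tau), (rep_delta delta_mu), p => w.
by rewrite mu_semE; apply: represents_sem rp.
Qed.

End Translation.

(** * Context-free grammars of Boolean systems *)

Section Grammar.
Variables (A X : finType).
Variables (o : X -> boolean) (delta : X -> A -> ncpoly boolean X).
Variable p0 : ncpoly boolean X.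
Implicit Types (p q : ncpoly boolean X) (v : seq X) (w : seq A).

Local Notation psem := (poly_sem o delta).
Local Notation word := (ncword boolean).
Local Notation sentence := (seq (option X + A)).

(** Boolean addition is disjunction, so it suffices to follow one summand of the product rule: the
    left one along [w1], then the right one. *)
Lemma poly_semM_cat p q w1 w2 :
  psem p w1 = 1 -> psem q w2 = 1 -> psem (p * q) (w1 ++ w2) = 1.
Proof.
move=> + q1; elim: w1 p => [|a w1 IHw] p p1.
  rewrite poly_sem_nil in p1.
  case: w2 q1 => [|a w2] q1; first by rewrite poly_sem_nil poly_outM p1 mul1r.
  rewrite /= poly_sem_cons poly_derM p1 scale1r poly_semD -poly_sem_cons q1.
  exact: orbT.
by rewrite /= poly_sem_cons poly_derM poly_semD IHw.
Qed.

Lemma boolean_sum_eq1 (I : eqType) (r : seq I) (F : I -> boolean) :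
  \sum_(i <- r) F i = 1 -> exists2 i, i \in r & F i = 1.
Proof.
elim: r => [|i r IHr]; rewrite ?big_nil // big_cons => /orP[Fi|/IHr[j rj Fj]].
  by exists i; rewrite ?mem_head.
by exists j; rewrite // inE rj orbT.
Qed.

Lemma boolean_finsupp p v : (v \in finsupp p) = p v.
Proof. by rewrite mem_finsupp; case: (p v). Qed.

Lemma poly_sem_supp p w :
  psem p w = 1 -> exists2 v, v \in finsupp p & psem (word v) w = 1.
Proof.
rewrite [p in psem p]ncpoly_expand /linext.
rewrite (big_morph (fun q => psem q w) (fun q q' => poly_semD _ _ q q' w)
           (poly_sem0 _ _ w)).
case/boolean_sum_eq1 => v vp; rewrite poly_semZ => /andP[_ pv].
by exists v.
Qed.

Lemma supp_mul_word p v u :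
  (p * word v) u = 1 -> exists2 u', p u' = 1 & u = u' ++ v.
Proof.
rewrite ncmulE => /boolean_sum_eq1[i _ /andP[pi]].
rewrite ncwordE; case: eqP => // <- _.
by exists (take i u); rewrite ?cat_take_drop.
Qed.

Definition sentence_of v : sentence := [seq inl (Some x) | x <- v].

(** The fresh start symbol [None] chooses a word of [p0]. An indeterminate is erased if its output
    is 1, or emits a letter and becomes a word of its derivative. *)
Definition cf_rules : seq (option X * sentence) :=
  [seq (None, sentence_of v) | v <- enum_fset (finsupp p0)]
  ++ [seq (Some x, [::]) | x <- enum X & o x]
  ++ [seq (Some xa.1, inr xa.2 :: sentence_of v)
       | xa <- enum {: X * A}, v <- enum_fset (finsupp (delta xa.1 xa.2))].

Definition cf_grammar : cfg A := Cfg None cf_rules.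

(** * Words of the series are derivable *)

Definition derives : sentence -> sentence -> Prop :=
  clos_refl_trans _ (@cfg_step A cf_grammar).

Lemma derives_rule y s t : (y, s) \in cf_rules -> derives (inl y :: t) (s ++ t).
Proof. by move=> ys; apply: rt_step; exists [::], t, (y, s). Qed.

Lemma derives_cons b s t : derives s t -> derives (b :: s) (b :: t).
Proof.
elim=> [s1 s2 [u [v [r [rr -> ->]]]]|s1|s1 s2 s3 _ IH1 _ IH2].
- by apply: rt_step; exists (b :: u), v, r.
- exact: rt_refl.
exact: rt_trans IH1 IH2.
Qed.

Lemma derives_start v t :
  v \in finsupp p0 -> derives (inl None :: t) (sentence_of v ++ t).
Proof.
move=> vp; apply: derives_rule; rewrite mem_cat; apply/orP; left.
exact: map_f.
Qed.

Lemma derives_nil x t : o x = 1 -> derives (inl (Some x) :: t) t.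
Proof.
move=> ox; apply: (@derives_rule _ [::]).
rewrite !mem_cat; apply/orP; right; apply/orP; left.
by apply: (map_f (fun x => (Some x, [::]))); rewrite mem_filter ox mem_enum.
Qed.

Lemma derives_der x a v t :
  delta x a v = 1 ->
  derives (inl (Some x) :: t) (inr a :: sentence_of v ++ t).
Proof.
move=> dv; apply: (@derives_rule _ (inr a :: sentence_of v)).
rewrite !mem_cat; apply/orP; right; apply/orP; right.
apply/allpairsPdep; exists (x, a), v; split=> //; first by rewrite mem_enum.
by rewrite -[_ \in _]/(v \in finsupp (delta x a)) boolean_finsupp dv.
Qed.

Lemma derives_word_der v a u :
  word_der o delta v a u = 1 ->
  derives (sentence_of v) (inr a :: sentence_of u).
Proof.
elim: v => [|x v IHv] /=; first by rewrite nczeroE.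
rewrite ncaddrE ncscalerE => /orP[/supp_mul_word[u' du' ->]|/andP[ox /IHv dv]].
  by rewrite /sentence_of map_cat; apply: derives_der.
by apply: rt_trans dv; apply: derives_nil.
Qed.

Lemma derives_word_out v : word_out o v = 1 -> derives (sentence_of v) [::].
Proof.
elim: v => [|x v IHv] /=; first by move=> _; apply: rt_refl.
by case/andP=> ox /IHv; apply: rt_trans; apply: derives_nil.
Qed.

Lemma poly_sem_derives v w :
  psem (word v) w = 1 -> derives (sentence_of v) (map inr w).
Proof.
elim: w v => [|a w IHw] v.
  by rewrite poly_sem_nil poly_out_word => /derives_word_out.
rewrite poly_sem_cons poly_der_word => /poly_sem_supp[u].
rewrite boolean_finsupp => /derives_word_der du /IHw dw.
by apply: rt_trans du _; apply: derives_cons.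
Qed.

(** * Derivable words belong to the series *)

Definition nonterm_poly (y : option X) : ncpoly boolean X :=
  if y is Some x then word [:: x] else p0.

(** This is the language of a sentential form when each nonterminal stands for its series; it is the
    invariant carried backwards along derivations. *)
Fixpoint yields (s : sentence) (w : seq A) : Prop :=
  match s with
  | [::] => w = [::]
  | inr a :: s' => exists2 w', w = a :: w' & yields s' w'
  | inl y :: s' => exists w1 w2,
      [/\ w = w1 ++ w2, psem (nonterm_poly y) w1 = 1 & yields s' w2]
  end.

Lemma yields_terminals w : yields (map inr w) w.
Proof. by elim: w => //= a w IHw; exists w. Qed.

Lemma yields_cat s t w :
  yields (s ++ t) w <->
  exists w1 w2, [/\ w = w1 ++ w2, yields s w1 & yields t w2].
Proof.
elim: s w => [|[y|a] s IHs] w /=.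
- split=> [tw|[_ [w2 [-> -> //]]]]; by exists [::], w.
- split=> [[w1 [w2 [-> yw1 /IHs[w3 [w4 [-> sw3 tw4]]]]]]|].
    by exists (w1 ++ w3), w4; split; rewrite ?catA //; exists w1, w3.
  case=> _ [w4 [-> [w1 [w3 [-> yw1 sw3]]] tw4]].
  exists w1, (w3 ++ w4); rewrite catA; split=> //.
  by apply/IHs; exists w3, w4.
split=> [[_ -> /IHs[w1 [w2 [-> sw1 tw2]]]]|].
  by exists (a :: w1), w2; split=> //; exists w1.
case=> _ [w2 [-> [w1 -> sw1] tw2]]; exists (w1 ++ w2) => //.
by apply/IHs; exists w1, w2.
Qed.

Lemma yields_sentence_of v w : yields (sentence_of v) w -> psem (word v) w = 1.
Proof.
elim: v w => [|x v IHv] w /=.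
  by move=> ->; rewrite poly_sem_nil poly_out_word.
case=> w1 [w2 [-> xw1 /IHv vw2]].
by rewrite -cat1s -ncwordM poly_semM_cat.
Qed.

Lemma poly_sem_incl p q w :
  (forall v, p v = 1 -> q v = 1) -> psem p w = 1 -> psem q w = 1.
Proof.
(* Since addition is idempotent, inclusion of supports is absorption of [p] by [q]. *)
move=> pq pw; suff -> : q = p + q by rewrite poly_semD pw.
apply: ncpolyP => v; rewrite ncaddrE.
by case pv: (p v) => //; rewrite pq.
Qed.

Lemma yields_rule y s w :
  (y, s) \in cf_rules -> yields s w -> psem (nonterm_poly y) w = 1.
Proof.
have word_incl p v u : v \in finsupp p -> word v u = 1 -> p u = 1.
  by rewrite boolean_finsupp ncwordE => pv; case: eqP => // ->.
rewrite !mem_cat => /or3P[].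
- case/mapP=> v vp [-> ->] /yields_sentence_of.
  by apply: poly_sem_incl => u; apply: word_incl.
- case/mapP=> x; rewrite mem_filter => /andP[ox _] [-> ->] /= ->.
  by rewrite poly_sem_nil poly_out_word /= ox.
case/allpairsPdep=> -[x a] [v [_ vd [-> ->]]] /=.
case=> w' -> /yields_sentence_of vw'.
rewrite poly_sem_cons poly_der_word /= scaler0 addr0 -[ncword _ _]/1 mulr1.
by apply: poly_sem_incl vw' => u; apply: word_incl.
Qed.

(** By [yields_cat] a rewrite in any position affects only its own factor of [w], so derivations
    need not be leftmost. *)
Lemma yields_derives s t w : derives s t -> yields t w -> yields s w.
Proof.
move=> st; elim: st w => [s1 s2 [u [v [[y r] [rr -> ->]]]]|//
                         |s1 s2 s3 _ IH1 _ IH2] w.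
  move=> /yields_cat[w1 [w2 [-> uw1 /yields_cat[w3 [w4 [-> rw3 vw4]]]]]].
  apply/yields_cat; exists w1, (w3 ++ w4); split=> //=.
  by exists w3, w4; split=> //; apply: yields_rule rr rw3.
by move=> /IH2/IH1.
Qed.

Lemma cf_grammarP w : psem p0 w = 1 <-> cfg_generates cf_grammar w.
Proof.
split=> [/poly_sem_supp[v vp vw]|/yields_derives/(_ (yields_terminals w))].
  apply: rt_trans (poly_sem_derives vw).
  by have := derives_start [::] vp; rewrite cats0.
by case=> w1 [w2 [-> p0w1 ->]]; rewrite cats0.
Qed.

End Grammar.

Lemma context_free_series_language (A : finType) (sigma : series boolean A) :
  context_free_series sigma -> context_free_language (fun w => sigma w = 1).
Proof.
case=> X [o [delta [p sigmaE]]]; exists (cf_grammar o delta p) => w.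
by rewrite sigmaE; apply: cf_grammarP.
Qed.

Theorem theorem6p12 (A : finType) :
  (forall (K : comPzSemiRingType) (t : closed_muexp K A),
     context_free_series (mu_sem t)) /\
  (forall t : closed_muexp boolean A,
     context_free_language (fun w => mu_sem t w = 1)).
Proof.
split=> [K t|t]; first exact: mu_sem_context_free.
exact/context_free_series_language/mu_sem_context_free.
Qed.
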